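(* Let $M$ be a simple matroid of rank $3$ with ground set of size $n$, let $c$ be the number of rank $2$ flats of $M$, and let $s$ be the sum of their sizes. Then the coarse flag polynomial of $M$ is $$\mathcal{N}_M(Y,T) = \pi_M(Y) + \varphi_M(Y)\,T + Y^3\pi_M(Y^{-1})\,T^2,$$ where $$\varphi_M(Y) = n+c-2 + (2s-n+c)Y + (2s-n+c)Y^2 + (n+c-2)Y^3.$$
   Context: Matroids: a matroid $M=(E,\mathcal{L}(M))$ is given by a finite ground set $E$ and its lattice of flats $\mathcal{L}(M)$ (ordered by inclusion, with bottom $\hat 0$, top $\hat 1=E$, rank function $r(X)$, and $r(M)=r(E)$). It is simple if its rank $0$ flat is $\varnothing$ and all rank $1$ flats are singletons. For flats $X\subseteq X'$, the lattice of flats of the minor $M/X|X'$ is isomorphic to the interval $[X,X']$ of $\mathcal{L}(M)$. The Möbius function is defined by $\mu_M(\hat 0)=1$, $\mu_M(X)=-\sum_{X'<X}\mu_M(X')$. The Poincaré polynomial is $\pi_M(Y)=\sum_{X\in\mathcal{L}(M)}\mu_M(X)(-Y)^{r(X)}$. Put $\overline{\mathcal{L}}(M)=\mathcal{L}(M)\setminus\{\hat 0,\hat 1\}$, and let $\Delta(\overline{\mathcal{L}}(M))$ be the set of all flags (finite chains, including the empty one) in it. For a flag $F=(X_1<\cdots<X_\ell)$, $\ell\ge 0$, with $X_0=\hat 0$, $X_{\ell+1}=\hat 1$, set $|F|=\ell$ and $\pi_F(Y)=\prod_{k=0}^{\ell}\pi_{M/X_k|X_{k+1}}(Y)$. The coarse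 flag polynomial is $$\mathcal{N}_M(Y,T)=\sum_{F\in\Delta(\overline{\mathcal{L}}(M))}\pi_F(Y)\,T^{|F|}(1-T)^{r(M)-1-|F|}.$$ *)

(* Defs.v *)
From HB Require Import structures.
From mathcomp Require Import all_boot all_order all_algebra.
Set Implicit Arguments.
Unset Strict Implicit.
Unset Printing Implicit Defensive.
Import Order.TTheory GRing.Theory Num.Theory.
Local Open Scope ring_scope.

Definition covers (U : finType) (L : {set {set U}}) (F G : {set U}) : bool :=
  [&& G \in L, F \proper G & [forall H in L, ~~ ((F \proper H) && (H \proper G))]].

(* The flat axioms; in the third one, the flats covering [F] partition the
   complement of [F] in the ground set. *)
Record is_matroid (U : finType) (E : {set U}) (L : {set {set U}}) : Prop :=
  IsMatroid {
    flat_sub_ground : forall F, F \in L -> F \subset E;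
    ground_flat : E \in L;
    flatI : forall F G, F \in L -> G \in L -> F :&: G \in L;
    flat_cover : forall F x, F \in L -> x \in E :\: F ->
      exists! G, covers L F G /\ x \in G }.

Record matroid (U : finType) := Matroid {
  ground : {set U};
  flats : {set {set U}};
  matroidP : is_matroid ground flats }.

Section Minors.
Variable U : finType.
Implicit Types (M : matroid U) (A F G X : {set U}).

Lemma coversP (L : {set {set U}}) F G :
  reflect [/\ G \in L, F \proper G
            & forall H, H \in L -> F \proper H -> H \subset G -> H = G]
          (covers L F G).
Proof.
apply: (iffP and3P) => [[GL FG /forall_inP h]|[GL FG h]]; split=> //.
  move=> H HL FH HG; apply/eqP; rewrite eqEproper HG.
  by have := h H HL; rewrite FH.
apply/forall_inP => H HL; apply/negP => /andP[FH HG].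
by have := HG; rewrite (h H HL FH (proper_sub HG)) properxx.
Qed.

Lemma contract_is_matroid M A :
  is_matroid (ground M :\: A)
    [set F :\: A | F in flats M & ground M :&: A \subset F].
Proof.
case: M => E L [/= subE EL LI Lcov].
have split_sub F G : F \in L -> E :&: A \subset G ->
    (F :\: A \subset G :\: A) = (F \subset G).
  move=> /subE/subsetP FE /subsetP AG; apply/idP/idP => [/subsetP h|]; last exact: setSD.
  apply/subsetP => x xF; case: (boolP (x \in A)) => xA.
    by apply: AG; rewrite inE FE.
  by have := h x; rewrite !inE xA xF => /(_ isT).
split.
- by move=> ? /imsetP[F]; rewrite inE => /andP[/subE FE _] ->; apply: setSD.
- by apply: imset_f; rewrite inE EL subsetIl.
- move=> ? ? /imsetP[F]; rewrite inE => /andP[FL AF] -> /imsetP[G].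
  rewrite inE => /andP[GL AG] ->; rewrite -setDIl; apply: imset_f.
  by rewrite inE LI // subsetI AF.
move=> ? x /imsetP[F]; rewrite inE => /andP[FL AF] ->.
rewrite !inE => /andP[xF /andP[xA xE]]; rewrite xA /= in xF.
have xEF : x \in E :\: F by rewrite inE xF.
have [G [[/coversP[GL FG minG] xG] uniG]] := Lcov F x FL xEF.
have AG : E :&: A \subset G := subset_trans AF (proper_sub FG).
have prop H K : H \in L -> K \in L -> E :&: A \subset H -> E :&: A \subset K ->
    (H :\: A \proper K :\: A) = (H \proper K).
  by move=> HL KL AH AK; rewrite !properE !split_sub.
exists (G :\: A); split.
  split; last by rewrite inE xA.
  apply/coversP; split; [by apply: imset_f; rewrite inE GL | by rewrite prop |].
  move=> ? /imsetP[H]; rewrite inE => /andP[HL AH] ->.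
  by rewrite prop // split_sub // => FH HG; rewrite (minG H).
move=> ? [/coversP[/imsetP[H]]]; rewrite inE => /andP[HL AH] ->.
rewrite prop // => FH minH; rewrite inE xA /= => xH.
rewrite (uniG H) //; split=> //; apply/coversP; split=> // K KL FK KH.
have AK : E :&: A \subset K := subset_trans AF (proper_sub FK).
apply/eqP; rewrite eqEsubset KH -(split_sub H) //= -(minH (K :\: A)) //.
- by apply: imset_f; rewrite inE KL.
- by rewrite prop.
- by rewrite split_sub.
Qed.

Definition contract M A := Matroid (contract_is_matroid M A).

Lemma restrict_is_matroid M A :
  is_matroid (ground M :&: A) [set F :&: A | F in flats M].
Proof.
case: M => E L [/= subE EL LI Lcov].
split.
- by move=> ? /imsetP[F /subE FE ->]; apply: setSI.
- exact: imset_f.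
- move=> ? ? /imsetP[F FL ->] /imsetP[G GL ->].
  by rewrite -setIIl; apply: imset_f; apply: LI.
move=> ? x /imsetP[F0 F0L ->]; set B := F0 :&: A.
(* the closure of B *)
pose F := E :&: \bigcap_(H in L | B \subset H) H.
have bigL (P : pred {set U}) : E :&: \bigcap_(H in L | P H) H \in L.
  elim/big_rec: _ => [|H G /andP[HL _] GL]; first by rewrite setIT.
  by rewrite setICA; apply: LI.
have FL : F \in L by apply: bigL.
have Fmin H : H \in L -> B \subset H -> F \subset H.
  by move=> HL BH; rewrite subIset // (bigcap_inf H) ?HL ?orbT.
have BF : B \subset F.
  rewrite subsetI (subset_trans (subsetIl _ _) (subE _ F0L)) /=.
  by apply/bigcapsP => H /andP[].
have FAB : F :&: A = B.
  apply/eqP; rewrite eqEsubset; apply/andP; split.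
    by apply: setSI; apply: Fmin => //; apply: subsetIl.
  by rewrite subsetI BF subsetIr.
rewrite in_setD => /andP[xB]; rewrite in_setI => /andP[xE xA].
have xF : x \notin F by apply: contra xB; rewrite -FAB in_setI xA andbT.
have xEF : x \in E :\: F by rewrite inE xF.
have [G [[/coversP[GL FG minG] xG] uniG]] := Lcov F x FL xEF.
have key H : H \in L -> B \proper H :&: A -> H :&: A \subset G :&: A ->
    H :&: A = G :&: A.
  move=> HL /properP[BH [y]]; rewrite in_setI => /andP[yH yA] yB HG.
  have yG : y \in G.
    by have /subsetP/(_ y) := HG; rewrite !inE yH yA => /(_ isT)/andP[].
  have FH : F \subset H by apply: Fmin => //; apply: subset_trans BH (subsetIl _ _).
  have HGG : H :&: G = G.
    apply: minG; [exact: LI | | exact: subsetIr].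
    apply/properP; split; first by rewrite subsetI FH proper_sub.
    exists y; first by rewrite inE yH.
    by apply: contra yB; rewrite -FAB in_setI yA andbT.
  apply/eqP; rewrite eqEsubset HG; apply: setSI.
  by rewrite -HGG subsetIl.
exists (G :&: A); split.
  split; last by rewrite inE xG.
  apply/coversP; split; first exact: imset_f.
    apply/properP; split; first by rewrite -FAB setSI // proper_sub.
    by exists x => //; rewrite inE xG.
  by move=> ? /imsetP[H HL ->] BH HG; apply: key.
move=> ? [/coversP[/imsetP[H HL ->] BH minH]]; rewrite in_setI => /andP[xH _].
have FH : F \subset H.
  by apply: Fmin => //; apply: subset_trans (proper_sub BH) (subsetIl _ _).
have BGH : B \proper G :&: H :&: A.
  apply/properP; split; last by exists x => //; rewrite !inE xG xH.
  by rewrite -FAB; apply: setSI; rewrite subsetI proper_sub.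
rewrite -(key (G :&: H)) //; [|exact: LI|by apply: setSI; apply: subsetIl].
apply: minH => //; first by apply: imset_f; apply: LI.
by apply: setSI; apply: subsetIr.
Qed.

Definition restrict M A := Matroid (restrict_is_matroid M A).

(* [M / X | X'], on the ground set [X' :\: X] when [X' \subset ground M]. *)
Definition minor M (X X' : {set U}) := restrict (contract M X) X'.

Lemma ground_minor M X X' :
  X' \subset ground M -> ground (minor M X X') = X' :\: X.
Proof. by move=> X'E; rewrite /= setIDAC (setIidPr X'E). Qed.

Lemma flats_minor M X X' : X \in flats M -> X' \in flats M -> X \subset X' ->
  flats (minor M X X') =
    [set F :\: X | F in flats M & (X \subset F) && (F \subset X')].
Proof.
case: M => E L [/= subE EL LI _] XL X'L XX'.
have XE : E :&: X = X by apply/setIidPr/subE.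
apply/setP => B; apply/imsetP/imsetP => -[F].
  case/imsetP => G; rewrite inE XE => /andP[GL XG] -> ->.
  by exists (G :&: X'); rewrite ?setIDAC // inE LI // subsetI XG XX' subsetIr.
rewrite inE => /and3P[FL XF FX'] ->; exists (F :\: X).
  by apply: imset_f; rewrite inE FL XE.
by rewrite setIDAC (setIidPl FX').
Qed.

End Minors.

Section FlagPolynomial.
Variable U : finType.
Implicit Types (M : matroid U) (X : {set U}) (F C : {set {set U}}).

Definition hat0 M : {set U} := \bigcap_(X in flats M) X.

Definition is_chain C : bool :=
  [forall A in C, forall B in C, (A \subset B) || (B \subset A)].

(* The length of a longest chain of flats from [hat0 M] up to [X], counted by
   its members other than [X]. *)
Definition rank M X : nat :=
  \max_(C : {set {set U}} | [&& is_chain C, C \subset flats M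
                              & [forall A in C, A \proper X]]) #|C|.

Definition rk M : nat := rank M (ground M).

Definition simple_matroid M : Prop :=
  (forall X, X \in flats M -> rank M X = 0%N -> X = set0) /\
  (forall X, X \in flats M -> rank M X = 1%N -> exists x, X = [set x]).

Fixpoint mobius_rec M (k : nat) X : int :=
  if k is k'.+1 then
    if X == hat0 M then 1
    else - \sum_(X' in flats M | X' \proper X) mobius_rec M k' X'
  else 0.

(* [#|X|.+1] is enough fuel, see [mobiusE]. *)
Definition mobius M X : int := mobius_rec M #|X|.+1 X.

Lemma mobius_hat0 M : mobius M (hat0 M) = 1.
Proof. by rewrite /mobius /= eqxx. Qed.

Lemma mobiusE M X : X != hat0 M ->
  mobius M X = - \sum_(X' in flats M | X' \proper X) mobius M X'.
Proof.
have fuel k m (Z : {set U}) : (#|Z| < k)%N -> (#|Z| < m)%N ->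
    mobius_rec M k Z = mobius_rec M m Z.
  elim: k m Z => // k IH [//|m] Z; rewrite !ltnS => Zk Zm /=.
  case: eqP => // _; congr (- _); apply: eq_bigr => Z' /andP[_ /proper_card lt].
  by apply: IH; apply: leq_trans lt _.
move=> /negbTE nX; rewrite {1}/mobius /= nX; congr (- _).
apply: eq_bigr => X' /andP[_ /proper_card lt]; exact: fuel.
Qed.

Definition poincare M : {poly int} :=
  \sum_(X in flats M) mobius M X *: (- 'X) ^+ rank M X.

Definition is_flag M F : bool :=
  (F \subset flats M :\: [set hat0 M; ground M]) && is_chain F.

(* The sequence [X_0 < X_1 < ... < X_(l+1)] attached to a flag. *)
Definition flag_seq M F : seq {set U} :=
  hat0 M :: rcons (sort (fun A B : {set U} => A \subset B) (enum F)) (ground M).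

Definition flag_poincare M F : {poly int} :=
  \prod_(k < #|F|.+1)
    poincare (minor M (nth set0 (flag_seq M F) k)
                      (nth set0 (flag_seq M F) k.+1)).

(* The outer variable is T, the coefficients are polynomials in Y. *)
Definition coarse_flag M : {poly {poly int}} :=
  \sum_(F : {set {set U}} | is_flag M F)
    (flag_poincare M F)%:P * 'X^#|F| * (1 - 'X) ^+ (rk M - 1 - #|F|).

Definition flats_of_rank M (k : nat) : {set {set U}} :=
  [set X in flats M | rank M X == k].

End FlagPolynomial.

Definition peval (R : nzRingType) (p : {poly int}) (y : R) : R :=
  (map_poly intr p).[y].

(* Y as a rational function, so that Y^-1 makes sense. *)
Definition fracY : {fraction {poly int}} := tofrac 'X.

(* Main.v *)
Require Import Defs.
From HB Require Import structures.
From mathcomp Require Import all_boot all_order all_algebra.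
From mathcomp Require Import ring.
Set Implicit Arguments.
Unset Strict Implicit.
Unset Printing Implicit Defensive.
Import Order.TTheory GRing.Theory Num.Theory.
Local Open Scope ring_scope.

(** The flats of a simple matroid [M] of rank 3 are the empty set, the [n]
    points, the [c] lines (flats of rank 2) and the ground set [E].  Hence the
    coarse flag polynomial is a sum over four kinds of flags only, and it
    remains to know the Poincaré polynomials of the intervals they cut out.

    An interval without interior has Poincaré polynomial [1 + Y]
    ([poincare_minor_cover]), and an interval of length two with [d] interior
    flats has [1 + d Y + (d - 1) Y^2] ([poincare_minor_three_levels]).  Möbius
    inversion over all of [M] gives
      [pi_M = 1 + n Y + (s - c) Y^2 + (1 - n + s - c) Y^3]
    ([poincare_simple_rank3]), since a line [F] has Möbius value [|F| - 1].
    The empty flag thus contributes [pi_M (1 - T)^2].  A point on [d] lines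
    contributes [(1 + Y) (1 + d Y + (d - 1) Y^2)] to the coefficient of
    [T (1 - T)], and a line [F] contributes
    [(1 + |F| Y + (|F| - 1) Y^2) (1 + Y)].  A point on a line contributes
    [(1 + Y)^3] to the coefficient of [T^2].  Counting incident pairs in two ways,
    the numbers [d] add up to [s], so every sum is a polynomial in
    [n], [c] and [s] ([coarse_flag_simple_rank3]).  Expanding in powers of [T]
    leaves [pi_M], [phi_M], and a cubic whose coefficients are those of [pi_M]
    in reverse order, which is [Y^3 pi_M (1 / Y)].

    The rank of a flat is defined by longest chains; it enters through its
    strict monotonicity ([rank_lt]) and the bound by the flats below
    ([rank_le]), which classify the flats.  The partition axiom enters twice, to see that every element is a point ([set1_flat]) and that
    every point lies on a line ([line_through]). *)

(** * Rank and chains of flats *)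

Section Rank.
Variables (U : finType) (M : matroid U).
Implicit Types (A X : {set U}) (C : {set {set U}}).

Lemma hat0_sub X : X \in flats M -> hat0 M \subset X.
Proof. by move=> XL; rewrite /hat0 (bigcap_inf X). Qed.

Lemma hat0_flat : hat0 M \in flats M.
Proof.
have [_ EL LI _] := matroidP M.
have -> : hat0 M = ground M :&: hat0 M by apply/esym/setIidPr/hat0_sub.
rewrite /hat0; elim/big_rec: _ => [|X Y XL]; first by rewrite setIT.
by rewrite setICA; apply: LI.
Qed.

Lemma hat0_unique A :
  A \in flats M -> {in flats M, forall X, A \subset X} -> hat0 M = A.
Proof.
move=> AL Amin; apply/eqP; rewrite eqEsubset hat0_sub //=.
exact: Amin hat0_flat.
Qed.

Lemma rank_attained X :
  exists C, [/\ is_chain C, C \subset flats M,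
    {in C, forall A, A \proper X} & rank M X = #|C|].
Proof.
pose P C := [&& is_chain C, C \subset flats M & [forall A in C, A \proper X]].
rewrite -[rank M X]/(\max_(C | P C) #|C|)%N.
have P0 : P set0.
  rewrite /P sub0set /is_chain; apply/and3P; split=> //.
    by apply/forall_inP => A; rewrite inE.
  by apply/forall_inP => A; rewrite inE.
have : (0 < #|P|)%N by apply/card_gt0P; exists set0.
case/(eq_bigmax_cond (fun C : {set {set U}} => #|C|)) => C.
by case/and3P => chC CL /forall_inP CX ->; exists C.
Qed.

(** A longest chain below [A] can be prolonged by [A] itself. *)
Lemma rank_lt A X : A \in flats M -> A \proper X -> (rank M A < rank M X)%N.
Proof.
move=> AL AX; have [C [chC CL CA ->]] := rank_attained A.
have AC : A \notin C by apply/negP => /CA; rewrite properxx.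
have -> : #|C|.+1 = #|A |: C| by rewrite cardsU1 AC.
apply: (@leq_bigmax_cond _ _ (fun C : {set {set U}} => #|C|)).
apply/and3P; split.
- apply/forall_inP => B /setU1P[->|BC]; apply/forall_inP => D /setU1P[->|DC].
  + by rewrite subxx.
  + by rewrite (proper_sub (CA _ DC)) orbT.
  + by rewrite (proper_sub (CA _ BC)).
  + by have /forall_inP/(_ _ BC)/forall_inP/(_ _ DC) := chC.
- by rewrite subUset sub1set AL.
- apply/forall_inP => B /setU1P[-> //|/CA BA].
  exact: proper_trans BA AX.
Qed.

(** A nonempty chain below [X] has a largest member, and its other members form
    a chain below that one. *)
Lemma rank_le X k :
  (forall A, A \in flats M -> A \proper X -> (rank M A < k)%N) -> (rank M X <= k)%N.
Proof.
move=> rk_lt; apply/bigmax_leqP => C /and3P[/forall_inP chC /subsetP CL].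
move=> /forall_inP CX; have [->|[A0 A0C]] := set_0Vmem C; first by rewrite cards0.
case: (@arg_maxnP _ A0 (mem C) (fun A : {set U} => #|A|) A0C) => A AC Amax.
have {}AC : A \in C := AC.
have below B : B \in C :\ A -> B \proper A.
  move=> /setD1P[BA BC]; have /forall_inP/(_ _ BC) := chC _ AC.
  case/orP => [AB|BsA]; last by rewrite properEneq BA.
  by case/eqP: BA; apply/esym/eqP; rewrite eqEcard AB; apply: Amax.
rewrite (cardsD1 A) AC add1n.
apply: leq_ltn_trans (rk_lt A (CL _ AC) (CX _ AC)).
apply: (@leq_bigmax_cond _ _ (fun C : {set {set U}} => #|C|)).
apply/and3P; split; last by apply/forall_inP.
- apply/forall_inP => B /setD1P[_ BC]; apply/forall_inP => D /setD1P[_ DC].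
  by have /forall_inP/(_ _ DC) := chC _ BC.
- by apply/subsetP => B /setD1P[_ /CL].
Qed.

Lemma rank_pred X k : rank M X = k.+1 ->
  exists A, [/\ A \in flats M, A \proper X & rank M A = k].
Proof.
move=> rX; case: (pickP [pred A | [&& A \in flats M, A \proper X & rank M A == k]]).
  by move=> A /and3P[AL AX /eqP rA]; exists A.
move=> none; suff : (rank M X <= k)%N by rewrite rX ltnn.
apply: rank_le => A AL AX; rewrite ltn_neqAle -ltnS -rX rank_lt // andbT.
by have := none A; rewrite /= AL AX => /= ->.
Qed.

Lemma rank_hat0 : rank M (hat0 M) = 0%N.
Proof.
apply/eqP; rewrite -leqn0; apply: rank_le => A AL.
by rewrite properE hat0_sub // andbF.
Qed.

Lemma rank_step A X : A \in flats M -> A \proper X ->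
  (forall B, B \in flats M -> B \proper X -> (rank M B <= rank M A)%N) ->
  rank M X = (rank M A).+1.
Proof.
by move=> AL AX h; apply/eqP; rewrite eqn_leq rank_lt // rank_le.
Qed.

End Rank.

(** * Poincaré polynomials of lattices of length one and two *)

Section SmallPoincare.
Variables (U : finType) (N : matroid U).
Implicit Types (A B X Y : {set U}) (S : {set {set U}}).

Lemma mobius_atom A X : A \proper X -> hat0 N = A ->
  (forall B, B \in flats N -> B \proper X -> B = A) -> mobius N X = -1.
Proof.
move=> AX h0 below.
rewrite mobiusE; last by rewrite h0; apply: contraTneq AX => ->; rewrite properxx.
rewrite (big_pred1 A) -?h0 ?mobius_hat0 // => B; rewrite h0.
apply/andP/eqP => [[]|->]; first exact: below.
by rewrite -{1}h0 hat0_flat.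
Qed.

Lemma poincare_two_flats A B :
  flats N = [set A; B] -> A \proper B -> poincare N = 1 + 'X.
Proof.
move=> LN AB; have AL : A \in flats N by rewrite LN set21.
have h0 : hat0 N = A.
  by apply: hat0_unique => // X; rewrite LN => /set2P[] ->; rewrite ?subxx ?proper_sub.
have below X : X \in flats N -> X \proper B -> X = A.
  by rewrite LN => /set2P[] ->; rewrite ?properxx.
have neqAB : A != B by move: AB; rewrite properEneq => /andP[].
have rA : rank N A = 0%N by rewrite -h0 rank_hat0.
have rB : rank N B = 1%N.
  by rewrite (@rank_step _ _ A) ?rA // => X XL /(below _ XL) ->; rewrite rA.
rewrite /poincare LN big_setU1 ?inE //= big_set1 rB (mobius_atom AB) //.
by rewrite -h0 mobius_hat0 rank_hat0 expr0 expr1 scale1r scaleN1r opprK.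
Qed.

(** [S] has to be nonempty: otherwise the lattice has length one, and the top
    element has rank 1. *)
Lemma poincare_three_levels A B S :
  flats N = A |: (B |: S) -> S != set0 ->
  {in S, forall X, A \proper X} -> {in S, forall X, X \proper B} ->
  {in S &, forall X Y, ~~ (X \proper Y)} ->
  poincare N = 1 + #|S|%:R *: 'X + (#|S|%:R - 1) *: 'X^2.
Proof.
move=> LN /set0Pn[X0 X0S] AS SB anti.
have AB : A \proper B by apply: proper_trans (AS _ X0S) (SB _ X0S).
have AL : A \in flats N by rewrite LN !inE eqxx.
have SL X : X \in S -> X \in flats N by rewrite LN !inE => ->; rewrite !orbT.
have h0 : hat0 N = A.
  apply: hat0_unique => // X; rewrite LN => /setU1P[->|/setU1P[->|/AS]].
  - exact: subxx.
  - exact: proper_sub.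
  - exact: proper_sub.
have rA : rank N A = 0%N by rewrite -h0 rank_hat0.
have belowS X Y : X \in S -> Y \in flats N -> Y \proper X -> Y = A.
  move=> XS; rewrite LN => /setU1P[//|/setU1P[->|YS]] YX.
    by have := proper_trans YX (SB _ XS); rewrite properxx.
  by have := anti _ _ YS XS; rewrite YX.
have rS X : X \in S -> rank N X = 1%N.
  move=> XS; rewrite (@rank_step _ _ A) ?rA ?AS // => Y YL /(belowS _ _ XS YL) ->.
  by rewrite rA.
have rB : rank N B = 2%N.
  rewrite (@rank_step _ _ X0) ?rS ?SL ?SB // => Y.
  rewrite LN => /setU1P[->|/setU1P[->|/rS ->//]]; first by rewrite rA.
  by rewrite properxx.
have mS X : X \in S -> mobius N X = -1.
  by move=> XS; apply: (@mobius_atom A) => // *; [exact: AS | exact: (belowS X)].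
have AnS : A \notin S by apply/negP => /AS; rewrite properxx.
have BnS : B \notin S by apply/negP => /SB; rewrite properxx.
have neqAB : A != B by move: AB; rewrite properEneq => /andP[].
have mB : mobius N B = #|S|%:R - 1.
  rewrite mobiusE ?h0 1?eq_sym // (eq_bigl (mem (A |: S))); last first.
    move=> X; rewrite LN !inE; apply/andP/orP.
      by case=> /or3P[->|/eqP ->|->]; rewrite ?properxx //; [left|right].
    by case=> [/eqP ->|XS]; rewrite ?eqxx ?AB ?SB ?XS ?orbT.
  rewrite big_setU1 //= -{1}h0 mobius_hat0 (eq_bigr _ mS) sumr_const.
  by rewrite mulNrn opprD opprK addrC.
rewrite /poincare LN big_setU1 ?inE ?negb_or ?neqAB //= big_setU1 //=.
rewrite rA rB mB -{1}h0 mobius_hat0 expr0 scale1r sqrrN -addrA; congr (_ + _).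
rewrite addrC; congr (_ + _); rewrite (eq_bigr (fun _ => 'X)).
  by rewrite sumr_const scaler_nat.
by move=> X XS; rewrite rS // mS // expr1 scaleN1r opprK.
Qed.

End SmallPoincare.

(** * Poincaré polynomials of short intervals *)

Section MinorPoincare.
Variables (U : finType) (M : matroid U).
Implicit Types (X F G : {set U}).

Lemma subset_setD2 X F G : X \subset F -> X \subset G ->
  (F :\: X \subset G :\: X) = (F \subset G).
Proof. by move=> XF XG; rewrite subDset setDE setUIr setUCr setIT (setUidPr XG). Qed.

Lemma proper_setD2 X F G : X \subset F -> X \subset G ->
  (F :\: X \proper G :\: X) = (F \proper G).
Proof. by move=> XF XG; rewrite !properE (subset_setD2 XF XG) (subset_setD2 XG XF). Qed.

Lemma poincare_minor_cover X (X' : {set U}) :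
  X \in flats M -> X' \in flats M -> X \proper X' ->
  (forall F, F \in flats M -> X \proper F -> F \subset X' -> F = X') ->
  poincare (minor M X X') = 1 + 'X.
Proof.
move=> XL X'L pXX' cov; have XX' := proper_sub pXX'.
apply: (@poincare_two_flats _ _ (X :\: X) (X' :\: X)); last by rewrite proper_setD2.
rewrite flats_minor //; apply/setP => B; apply/imsetP/set2P.
  case=> F; rewrite inE => /and3P[FL XF FX'] ->.
  have [->|neqXF] := eqVneq X F; [by left|right].
  by rewrite (cov F) // properEneq neqXF.
by case=> ->; [exists X|exists X'] => //; rewrite inE ?XL ?X'L subxx ?XX'.
Qed.

Lemma poincare_minor_three_levels X (X' : {set U}) :
    X \in flats M -> X' \in flats M ->
  let S := [set F in flats M | (X \proper F) && (F \proper X')] in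
    S != set0 -> {in S &, forall F G, ~~ (F \proper G)} ->
  poincare (minor M X X') = 1 + #|S|%:R *: 'X + (#|S|%:R - 1) *: 'X^2.
Proof.
move=> XL X'L S S0 anti; have [F0] := set0Pn _ S0.
rewrite inE => /and3P[F0L XF0 F0X'].
have XX' := subset_trans (proper_sub XF0) (proper_sub F0X').
have SX F : F \in S -> X \subset F by rewrite inE => /and3P[_ /proper_sub].
have inj : {in S &, injective (fun F => F :\: X)}.
  move=> F G /SX XF /SX XG eqFG; apply/eqP.
  by rewrite eqEsubset -(subset_setD2 XF XG) -(subset_setD2 XG XF) eqFG subxx.
rewrite -(card_in_imset inj).
apply: (@poincare_three_levels _ _ (X :\: X) (X' :\: X)).
- rewrite flats_minor //; apply/setP => B; apply/imsetP/setU1P.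
    case=> F; rewrite inE => /and3P[FL XF FX'] ->.
    have [->|neqXF] := eqVneq X F; [by left|right].
    have [->|neqFX'] := eqVneq F X'; apply/setU1P; [by left|right].
    by apply: imset_f; rewrite inE FL !properEneq neqXF neqFX' XF.
  case=> [->|/setU1P[->|/imsetP[F FS ->]]].
  + by exists X; rewrite // inE XL subxx.
  + by exists X'; rewrite // inE X'L subxx XX'.
  + exists F => //; move: FS; rewrite !inE => /and3P[-> ? ?].
    by rewrite !proper_sub.
- by case/set0Pn: S0 => F FS; apply/set0Pn; exists (F :\: X); apply: imset_f.
- by move=> _ /imsetP[F FS ->]; rewrite (proper_setD2 (subxx X) (SX F FS)) //;
  case/setIdP: FS => _ /andP[].
- by move=> _ /imsetP[F FS ->]; rewrite (proper_setD2 (SX F FS) XX') //;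
  case/setIdP: FS => _ /andP[].
- move=> _ _ /imsetP[F FS ->] /imsetP[G GS ->].
  by rewrite (proper_setD2 (SX F FS) (SX G GS)); apply: anti.
Qed.

End MinorPoincare.

(** * Flags with at most two members *)

Section Flags.
Variables (U : finType) (M : matroid U).
Implicit Types (A B X : {set U}) (F C : {set {set U}}).
Let P := flats M :\: [set hat0 M; ground M].

(** A matroid also carries its ground set and a proof of the axioms, so matroids
    with equal flats need not be equal terms. *)
Lemma poincare_eq_flats (N : matroid U) : flats M = flats N -> poincare M = poincare N.
Proof.
move=> eqL; have eqr X : rank M X = rank N X by rewrite /rank eqL.
have eqm k X : mobius_rec M k X = mobius_rec N k X.
  elim: k X => //= k IH X; rewrite /hat0 -eqL; case: ifP => // _.
  by congr (- _); apply: eq_bigr.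
by rewrite /poincare -eqL; apply: eq_bigr => X _; rewrite eqr /mobius eqm.
Qed.

Lemma proper_flatP A :
  reflect [/\ A \in flats M, hat0 M \proper A & A \proper ground M] (A \in P).
Proof.
rewrite !inE negb_or; apply: (iffP andP) => [[/andP[A0 AE] AL]|[AL A0 AE]].
  split=> //; first by rewrite properEneq eq_sym A0 hat0_sub.
  by rewrite properEneq AE (flat_sub_ground (matroidP M)).
by split=> //; move: A0 AE; rewrite !properEneq eq_sym => /andP[-> _] /andP[-> _].
Qed.

(** Adding the least flat to a flag gives a chain that competes in the
    definition of the rank. *)
Lemma card_flag F : hat0 M \proper ground M -> is_flag M F -> (#|F| < rk M)%N.
Proof.
move=> h0E /andP[/subsetP FP /forall_inP chF].
have h0F : hat0 M \notin F by apply/negP => /FP; rewrite !inE eqxx.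
have -> : #|F|.+1 = #|hat0 M |: F| by rewrite cardsU1 h0F.
apply: (@leq_bigmax_cond _ _ (fun C : {set {set U}} => #|C|)).
apply/and3P; split.
- apply/forall_inP => A /setU1P[->|AF]; apply/forall_inP => B /setU1P[->|BF].
  + by rewrite subxx.
  + by have /proper_flatP[_ /proper_sub ->] := FP _ BF.
  + by have /proper_flatP[_ /proper_sub -> _] := FP _ AF; rewrite orbT.
  + by have /forall_inP/(_ _ BF) := chF _ AF.
- by apply/subsetP => A /setU1P[->|/FP/proper_flatP[]//]; exact: hat0_flat.
- by apply/forall_inP => A /setU1P[->|/FP/proper_flatP[]].
Qed.

(** The flags are sorted by cardinality; those with two members are
    parametrized by ordered pairs [A \proper B]. *)
Lemma sum_flags_le2 (V : nmodType) (g : {set {set U}} -> V) :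
  (forall F, is_flag M F -> (#|F| <= 2)%N) ->
  \sum_(F | is_flag M F) g F =
    g set0 + \sum_(A in P) g [set A]
    + \sum_(A in P) \sum_(B in P | A \proper B) g [set A; B].
Proof.
move=> le2.
have chainP F : reflect {in F &, forall A B, (A \subset B) || (B \subset A)} (is_chain F).
  apply: (iffP forall_inP) => h A; first by move=> B AF; have /forall_inP := h A AF; apply.
  by move=> AF; apply/forall_inP => B; apply: h.
rewrite (bigID (fun F => #|F| == 0%N)) /= (big_pred1 set0); last first.
  move=> F; rewrite cards_eq0; apply: andb_idl => /eqP ->.
  by rewrite /is_flag sub0set; apply/chainP => A B; rewrite inE.
rewrite (bigID (fun F => #|F| == 1%N)) /= addrA; congr (_ + _ + _).
  rewrite -(big_imset _ (in2W set1_inj)) /=; apply: eq_bigl => F.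
  apply/andP/imsetP => [[/andP[fl _] /cards1P[A eqF]]|[A AP ->]].
    by exists A => //; case/andP: fl => /subsetP FP _; apply: FP; rewrite eqF set11.
  rewrite cards1; split=> //; rewrite andbT /is_flag sub1set AP; apply/chainP.
  by move=> B B' /set1P -> /set1P ->; rewrite subxx.
pose PP := [set p : {set U} * {set U} | [&& p.1 \in P, p.2 \in P & p.1 \proper p.2]].
have inj : {in PP &, injective (fun p => [set p.1; p.2])}.
  move=> [A B] [A' B']; rewrite !inE /= => /and3P[_ _ AB] /and3P[_ _ AB'] eqF.
  have : A \in [set A'; B'] by rewrite -eqF set21.
  have : B \in [set A'; B'] by rewrite -eqF set22.
  case/set2P => eB /set2P[] eA; subst A B => //.
  - by rewrite properxx in AB.
  - by have := proper_trans AB AB'; rewrite properxx.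
  - by rewrite properxx in AB.
rewrite (eq_bigr (fun A => \sum_(B in P) if A \proper B then g [set A; B] else 0)); last first.
  by move=> A _; rewrite big_mkcondr.
rewrite pair_big_dep /= -big_mkcondr /=.
transitivity (\sum_(p in PP) g [set p.1; p.2]); last first.
  by apply: eq_bigl => p; rewrite inE andbA.
rewrite -(big_imset _ inj) /=; apply: eq_bigl => F.
apply/idP/imsetP => [/andP[/andP[fl n0] n1]|[[A B]]].
  have /cards2P[A [B [neqAB eqF]]] : #|F| == 2%N.
    by have := le2 F fl; case: #|F| n0 n1 => [|[|[|]]].
  case/andP: fl => /subsetP FP /chainP chF.
  have [AF BF] : A \in F /\ B \in F by rewrite eqF set21 set22.
  case/orP: (chF _ _ AF BF) => sub.
    by exists (A, B); rewrite // inE !FP //= properEneq neqAB.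
  exists (B, A); last by rewrite eqF setUC.
  by rewrite inE !FP //= properEneq eq_sym neqAB.
rewrite inE /= => /and3P[AP BP AB] ->.
have neqAB : A != B by move: AB; rewrite properEneq => /andP[].
rewrite cards2 neqAB /= !andbT /is_flag subUset !sub1set AP BP; apply/chainP.
by move=> X Y /set2P[] -> /set2P[] ->; rewrite ?subxx ?(proper_sub AB) ?orbT.
Qed.

(** When [hat0 M] is empty, the minor of the interval from [hat0 M] to the
    ground set has literally the same flats as [M]. *)
Lemma flag_poincare0 : hat0 M = set0 -> flag_poincare M set0 = poincare M.
Proof.
move=> h0; have [subE EL _ _] := matroidP M.
rewrite /flag_poincare /flag_seq enum_set0 cards0 big_ord_recl big_ord0 mulr1 /= h0.
apply/esym/poincare_eq_flats; rewrite flats_minor ?sub0set // -?h0 ?hat0_flat //.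
rewrite h0; apply/setP => A; apply/idP/imsetP => [AL|[F]].
  by exists A; rewrite ?setD0 // inE AL sub0set subE.
by rewrite inE => /andP[FL _] ->; rewrite setD0.
Qed.

Lemma flag_poincare1 A : flag_poincare M [set A] =
  poincare (minor M (hat0 M) A) * poincare (minor M A (ground M)).
Proof.
by rewrite /flag_poincare /flag_seq enum_set1 cards1 !big_ord_recl big_ord0 mulr1.
Qed.

Lemma flag_poincare2 A B : A \proper B -> flag_poincare M [set A; B] =
  poincare (minor M (hat0 M) A) * poincare (minor M A B)
  * poincare (minor M B (ground M)).
Proof.
move=> AB; have neqAB : A != B by move: AB; rewrite properEneq => /andP[].
have srt : sort (fun A B : {set U} => A \subset B) (enum [set A; B]) = [:: A; B].
  transitivity (sort (fun A B : {set U} => A \subset B) [:: A; B]); last first.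
    by rewrite /sort /= (proper_sub AB).
  apply/perm_sort_inP.
  - move=> X Y; rewrite !mem_enum => /set2P[] -> /set2P[] ->;
    by rewrite ?subxx ?(proper_sub AB) ?orbT.
  - by move=> X Y Z _ _ _; apply: subset_trans.
  - by move=> X Y _ _; rewrite -eqEsubset => /eqP.
  - apply: uniq_perm; rewrite ?enum_uniq //= ?inE ?neqAB // => X.
    by rewrite mem_enum !inE.
by rewrite /flag_poincare /flag_seq srt cards2 neqAB !big_ord_recl big_ord0 mulr1 mulrA.
Qed.

End Flags.

(** * Simple matroids of rank 3 *)

Lemma sum_affine (R : comNzRingType) (T : finType) (D : {set T}) (f : T -> nat)
  (u v : R) :
  \sum_(i in D) (u + (f i)%:R * v) = #|D|%:R * u + (\sum_(i in D) f i)%:R * v.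
Proof. by rewrite big_split /= sumr_const mulr_natl -mulr_suml -natr_sum. Qed.

Section SimpleRankThree.
Variables (U : finType) (M : matroid U).
Hypotheses (M_simple : simple_matroid M) (M_rank3 : rk M = 3%N).
Implicit Types (x y : U) (A F G X : {set U}).
Let E := ground M.
Let L := flats M.
Let lines := flats_of_rank M 2.
Let n := #|E|.
Let c := #|lines|.
Let s := (\sum_(F in lines) #|F|)%N.

Lemma hat0_simple : hat0 M = set0.
Proof. by case: M_simple => h _; apply: h; rewrite ?hat0_flat ?rank_hat0. Qed.

Lemma set0_flat : set0 \in L. Proof. by rewrite -hat0_simple hat0_flat. Qed.

(** The flat covering the empty set and containing [x] has rank 1, and simplicity
    makes it a singleton. *)
Lemma set1_flat x : x \in E -> [set x] \in L /\ rank M [set x] = 1%N.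
Proof.
move=> xE; have [_ _ _ cov] := matroidP M.
have [|G [[/coversP[GL G0 Gmin] xG] _]] := cov set0 x set0_flat; first by rewrite setD0.
have rG : rank M G = 1%N.
  rewrite (@rank_step _ _ set0) ?set0_flat // -hat0_simple rank_hat0 //.
  move=> B BL BG; rewrite leqn0; apply/eqP; rewrite (_ : B = hat0 M) ?rank_hat0 //.
  rewrite hat0_simple; have [//|B0] := eqVneq B set0.
  have eqBG : B = G by apply: Gmin; rewrite ?proper0 ?proper_sub.
  by rewrite eqBG properxx in BG.
have [y eqG] := M_simple.2 G GL rG.
by move: xG rG GL; rewrite eqG => /set1P <-.
Qed.

Lemma lineP F : reflect (F \in L /\ rank M F = 2%N) (F \in lines).
Proof. by rewrite inE; apply: (iffP andP) => -[? /eqP]. Qed.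

Lemma flat_cases F : F \in L ->
  [\/ F = set0, F = E, exists2 x, x \in E & F = [set x] | F \in lines].
Proof.
move=> FL; have sub := flat_sub_ground (matroidP M) FL.
have [->|neqFE] := eqVneq F E; first by constructor 2.
have : (rank M F < 3)%N by rewrite -M_rank3 rank_lt // properEneq neqFE.
case rF : (rank M F) => [|[|[|//]]] _.
- by constructor 1; apply: M_simple.1.
- have [x eqF] := M_simple.2 F FL rF; constructor 3; exists x => //.
  by apply: (subsetP sub); rewrite eqF set11.
- by constructor 4; apply/lineP.
Qed.

Lemma line_proper F : F \in lines -> F \proper E.
Proof.
case/lineP => FL rF; rewrite properEneq (flat_sub_ground (matroidP M)) // andbT.
by apply/eqP => eqF; have := M_rank3; rewrite /rk -/E -eqF rF.
Qed.

Lemma point_sub_line x F : F \in lines -> ([set x] \proper F) = (x \in F).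
Proof.
move=> FL; have FE := line_proper FL; apply/idP/idP => [/proper_sub|xF].
  by rewrite sub1set.
rewrite properEneq sub1set xF andbT; apply/eqP => eqF.
have [_] := set1_flat (subsetP (proper_sub FE) _ xF).
by case/lineP: FL => _; rewrite eqF => ->.
Qed.

Lemma line_neq0 F : F \in lines -> F != set0.
Proof.
case/lineP => _ rF; apply/eqP => eqF.
by move: rF; rewrite eqF -hat0_simple rank_hat0.
Qed.

Lemma line_antichain : {in lines &, forall F G, ~~ (F \proper G)}.
Proof.
move=> F G /lineP[FL rF] /lineP[_ rG]; apply/negP => /(rank_lt FL).
by rewrite rF rG.
Qed.

Lemma point_proper x : x \in E -> [set x] \proper E.
Proof.
move=> xE; have [_ rx] := set1_flat xE; rewrite properEneq sub1set xE andbT.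
by apply/eqP => eqE; have := M_rank3; rewrite /rk -/E -eqE rx.
Qed.

Lemma below_line F : F \in lines ->
  [set X in L | X \proper F] = set0 |: [set [set x] | x in F].
Proof.
move=> FL; have FE := line_proper FL.
apply/setP => X; rewrite inE; apply/andP/setU1P => [[XL XF]|].
  case: (flat_cases XL) XF => [->|->|[x _ ->]|XL2]; first by left.
  - by move=> EF; have := proper_trans EF FE; rewrite properxx.
  - by rewrite point_sub_line // => xF; right; apply: imset_f.
  - by rewrite (negPf (line_antichain XL2 FL)).
case=> [->|/imsetP[x xF ->]]; first by rewrite set0_flat proper0 line_neq0.
rewrite point_sub_line //; split=> //.
by case: (set1_flat (subsetP (proper_sub FE) _ xF)).
Qed.

(** Take a line [F] missing [x] and a point [a] of [F]. The flat [G] that covers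
    [[set a]] and contains [x] is a line: it is not the ground set, because [F]
    would lie strictly between [[set a]] and [G]. *)
Lemma line_through x : x \in E -> exists2 F, F \in lines & x \in F.
Proof.
move=> xE; have [F [FL FE rF]] := rank_pred M_rank3.
have Fl : F \in lines by apply/lineP.
have [xF|xF] := boolP (x \in F); first by exists F.
have /set0Pn[a aF] := line_neq0 Fl.
have aE := subsetP (proper_sub FE) _ aF.
have [aL _] := set1_flat aE.
have neqxa : x \notin [set a] by apply: contra xF => /set1P ->.
have [|G [[/coversP[GL aG Gmin] xG] _]] := flat_cover (matroidP M) (x := x) aL.
  by rewrite inE neqxa.
exists G => //; case: (flat_cases GL) => // [eqG|eqG|[y _ eqG]].
- by rewrite eqG inE in xG.
- have eqF : F = G by apply: Gmin; rewrite ?point_sub_line // eqG proper_sub.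
  by rewrite eqF xG in xF.
- by move: xG neqxa (proper_sub aG); rewrite eqG sub1set !inE => /eqP <- /eqP + /eqP /esym.
Qed.

Lemma sum_proper_flats (V : nmodType) (f : {set U} -> V) :
  \sum_(X in L :\: [set hat0 M; E]) f X =
    \sum_(x in E) f [set x] + \sum_(F in lines) f F.
Proof.
have -> : L :\: [set hat0 M; E] = [set [set x] | x in E] :|: lines.
  apply/setP => X; apply/proper_flatP/setUP; rewrite hat0_simple.
    case=> /flat_cases[->|->|[x xE ->]|XL]; rewrite ?properxx //; last by right.
    by left; apply: imset_f.
  case=> [/imsetP[x xE ->]|XL].
    rewrite point_proper // proper0 -card_gt0 cards1.
    by have [xL _] := set1_flat xE.
  by rewrite line_proper // proper0 line_neq0 //; have [] := lineP _ XL.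
have dis : [disjoint [set [set x] | x in E] & lines].
  rewrite disjoint_subset; apply/subsetP => _ /imsetP[x xE ->].
  by apply/negP => /lineP[_]; rewrite (set1_flat xE).2.
rewrite (eq_bigl [predU [set [set x] | x in E] & lines]) => [|X]; last by rewrite !inE.
rewrite bigU //=; congr (_ + _).
by rewrite big_imset // => x y _ _ /set1_inj.
Qed.

Lemma sum_flats (V : nmodType) (f : {set U} -> V) :
  \sum_(X in L) f X =
    f set0 + (f E + (\sum_(x in E) f [set x] + \sum_(F in lines) f F)).
Proof.
have h0E : hat0 M != E.
  by apply/eqP => e; have := M_rank3; rewrite /rk -/E -e rank_hat0.
rewrite -sum_proper_flats -hat0_simple.
rewrite (big_setD1 (hat0 M)) ?hat0_flat //= (big_setD1 E) /=.
  by rewrite setDDl.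
by rewrite !inE eq_sym h0E (ground_flat (matroidP M)).
Qed.

Lemma mobius_point x : x \in E -> mobius M [set x] = -1.
Proof.
move=> xE; apply: (@mobius_atom _ _ set0) => //.
- by rewrite proper0 -card_gt0 cards1.
- exact: hat0_simple.
- move=> B _; rewrite properE subset1 => /andP[/orP[]/eqP -> //].
  by rewrite subxx.
Qed.

Lemma mobius_line F : F \in lines -> mobius M F = #|F|%:R - 1.
Proof.
move=> FL; rewrite mobiusE ?hat0_simple ?line_neq0 //.
rewrite (eq_bigl (mem (set0 |: [set [set x] | x in F]))); last first.
  by move=> X; rewrite -below_line // [RHS]inE.
rewrite big_setU1 /=; last by apply/imsetP => -[x _ /setP/(_ x)]; rewrite !inE eqxx.
rewrite -{1}hat0_simple mobius_hat0 big_imset /=; last by move=> x y _ _ /set1_inj.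
rewrite (eq_bigr (fun=> -1)) ?sumr_const ?mulNrn ?opprD ?opprK 1?addrC // => x xF.
by apply/mobius_point/(subsetP (proper_sub (line_proper FL))).
Qed.

Lemma sum_mobius_lines : \sum_(F in lines) mobius M F = s%:R - c%:R.
Proof.
by rewrite (eq_bigr _ mobius_line) sumrB sumr_const -natr_sum.
Qed.

(** The Möbius values of all flats add up to zero. *)
Lemma mobius_ground : mobius M E = n%:R - 1 - (s%:R - c%:R).
Proof.
have E0 : E != set0.
  by apply/eqP => e; have := M_rank3; rewrite /rk -/E e -hat0_simple rank_hat0.
have := sum_flats (mobius M).
rewrite -{1}hat0_simple mobius_hat0 sum_mobius_lines (eq_bigr _ mobius_point).
rewrite (bigD1 E) ?(ground_flat (matroidP M)) //=.
rewrite (eq_bigl (fun X => (X \in flats M) && (X \proper E))); last first.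
  move=> X; apply: andb_id2l => XL.
  by rewrite properEneq (flat_sub_ground (matroidP M)) // andbT.
rewrite {1}mobiusE ?hat0_simple // addNr sumr_const mulNrn => h.
by apply/eqP; rewrite -subr_eq0 [X in _ == X]h -/n; apply/eqP; ring.
Qed.

Lemma poincare_simple_rank3 : poincare M =
  1 + n%:R * 'X + (s%:R - c%:R) * 'X^2 + (1 - n%:R + s%:R - c%:R) * 'X^3.
Proof.
have rE : rank M E = 3%N := M_rank3.
rewrite /poincare sum_flats.
rewrite -{1 2}hat0_simple mobius_hat0 rank_hat0 rE mobius_ground.
rewrite (eq_bigr (fun=> 'X)); last first.
  by move=> x xE; rewrite mobius_point // (set1_flat xE).2 scaleN1r opprK.
rewrite (eq_bigr (fun F => mobius M F *: 'X^2)); last first.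
  by move=> F /lineP[_ ->]; rewrite sqrrN.
rewrite -scaler_suml sum_mobius_lines sumr_const -mulr_natl -!mul_polyC.
rewrite !rmorphB /= !rmorph_nat rmorph1 -/n; ring.
Qed.

Lemma poincare_below_point x : x \in E -> poincare (minor M (hat0 M) [set x]) = 1 + 'X.
Proof.
move=> xE; have [xL rx] := set1_flat xE.
apply: poincare_minor_cover; rewrite ?hat0_flat // hat0_simple.
  by rewrite proper0 -card_gt0 cards1.
by move=> F _; rewrite proper0 subset1 => /negPf -> /orP[/eqP|].
Qed.

Lemma poincare_above_line F : F \in lines -> poincare (minor M F E) = 1 + 'X.
Proof.
move=> Fl; have [FL rF] := lineP _ Fl.
apply: poincare_minor_cover; rewrite ?line_proper ?(ground_flat (matroidP M)) //.
move=> G GL FG GE; apply/eqP; apply: contraTT FG => nGE.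
have : (rank M G < 3)%N by rewrite -M_rank3 rank_lt // properEneq nGE.
by rewrite ltnS leqNgt -rF; apply: contra; apply: rank_lt.
Qed.

Lemma poincare_point_line x F : x \in F -> F \in lines ->
  poincare (minor M [set x] F) = 1 + 'X.
Proof.
move=> xF Fl; have [FL rF] := lineP _ Fl.
have [xL rx] := set1_flat (subsetP (proper_sub (line_proper Fl)) _ xF).
apply: poincare_minor_cover; rewrite ?point_sub_line //.
move=> G GL xG GF; apply/eqP; apply: contraTT xG => nGF.
have : (rank M G < 2)%N by rewrite -rF rank_lt // properEneq nGF.
by rewrite ltnS leqNgt -rx; apply: contra; apply: rank_lt.
Qed.

Lemma poincare_below_line F : F \in lines ->
  poincare (minor M (hat0 M) F) = 1 + #|F|%:R *: 'X + (#|F|%:R - 1) *: 'X^2.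
Proof.
move=> Fl; have [FL rF] := lineP _ Fl; rewrite hat0_simple.
have eqS : [set G in flats M | (set0 \proper G) && (G \proper F)] =
    [set [set x] | x in F].
  apply/setP => X; rewrite inE andbCA proper0.
  have /setP/(_ X) := below_line Fl; rewrite !inE => ->.
  have [->|//] := eqVneq X set0; apply/esym/imsetP => -[x _ /setP/(_ x)].
  by rewrite !inE eqxx.
rewrite poincare_minor_three_levels ?set0_flat // eqS.
- by rewrite card_imset //; apply: set1_inj.
- have /set0Pn[x xF] := line_neq0 Fl; apply/set0Pn; exists [set x]; exact: imset_f.
- move=> _ _ /imsetP[x _ ->] /imsetP[y _ ->]; apply/negP => /proper_card.
  by rewrite !cards1.
Qed.

(** The interior of the interval is nonempty by [line_through], so it has length
    two. *)
Lemma poincare_above_point x : x \in E ->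
  let d := #|[set F in lines | x \in F]| in
  poincare (minor M [set x] E) = 1 + d%:R *: 'X + (d%:R - 1) *: 'X^2.
Proof.
move=> xE; have [xL rx] := set1_flat xE.
have eqS : [set G in flats M | ([set x] \proper G) && (G \proper E)] =
    [set F in lines | x \in F].
  apply/setP => X; rewrite [LHS]inE [RHS]inE.
  apply/and3P/andP => [[XL xX XE]|[Xl xX]]; last first.
    by rewrite point_sub_line // line_proper //; have [] := lineP _ Xl.
  case: (flat_cases XL) xX XE => [->|->|[y _ ->]|Xl].
  - by rewrite properE sub1set inE.
  - by rewrite properxx.
  - by move=> /proper_card; rewrite !cards1.
  - by rewrite point_sub_line.
rewrite poincare_minor_three_levels ?(ground_flat (matroidP M)) // eqS //.
- by have [F Fl xF] := line_through xE; apply/set0Pn; exists F; rewrite inE Fl.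
- by move=> F G /setIdP[Fl _] /setIdP[Gl _]; apply: line_antichain.
Qed.

(** Double counting of the incident pairs of a point and a line. *)
Lemma sum_lines_through : (\sum_(x in E) #|[set F in lines | x \in F]|)%N = s.
Proof.
rewrite (eq_bigr (fun x => \sum_(F in lines | x \in F) 1)%N); last first.
  by move=> x _; rewrite sum1dep_card.
rewrite (exchange_big_dep (mem lines)) /=; last by move=> x F _ /andP[].
apply: eq_bigr => F Fl; rewrite -sum1_card; apply: eq_bigl => x; rewrite Fl.
by apply: andb_idl; apply/subsetP/proper_sub/line_proper.
Qed.


(** The three summands come from the flags with zero, one and two members. *)
Lemma coarse_flag_simple_rank3 :
  let Y : {poly int} := 'X in
  let lin : {poly int} :=
    (1 + Y) * (n%:R + c%:R + (2 * s%:R) * Y + (2 * s%:R - n%:R - c%:R) * Y ^+ 2) in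
  coarse_flag M =
    (poincare M)%:P * (1 - 'X) ^+ 2 + lin%:P * ('X * (1 - 'X))
    + (s%:R * (1 + Y) ^+ 3)%:P * 'X^2.
Proof.
move=> Y lin.
have h0E : hat0 M \proper E.
  rewrite properEneq hat0_sub ?(ground_flat (matroidP M)) // andbT.
  by apply/eqP => e; have := M_rank3; rewrite /rk -/E -e rank_hat0.
rewrite /coarse_flag sum_flags_le2; last first.
  by move=> F /(card_flag h0E); rewrite M_rank3.
rewrite (flag_poincare0 hat0_simple) cards0 M_rank3 expr0 mulr1.
congr (_ + _ + _).
  rewrite (eq_bigr (fun A => (poincare (minor M (hat0 M) A) * poincare (minor M A E))%:P
                             * ('X * (1 - 'X)))); last first.
    by move=> A _; rewrite flag_poincare1 cards1 expr1 -mulrA.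
  rewrite -mulr_suml -rmorph_sum /=; congr (_%:P * _).
  rewrite sum_proper_flats.
  (* A point on [k] lines and a line with [k] points contribute the same value
     [u + k * v]. *)
  pose u : {poly int} := (1 + Y) * (1 - Y ^+ 2).
  pose v : {poly int} := (1 + Y) * (Y + Y ^+ 2).
  rewrite (eq_bigr (fun x => u + #|[set F in lines | x \in F]|%:R * v)); last first.
    move=> x xE; rewrite poincare_below_point // poincare_above_point //.
    by rewrite -!mul_polyC rmorphB rmorph1 rmorph_nat /u /v /Y; ring.
  rewrite (eq_bigr (fun F : {set U} => u + #|F|%:R * v)); last first.
    move=> F Fl; rewrite poincare_below_line // poincare_above_line //.
    by rewrite -!mul_polyC rmorphB rmorph1 rmorph_nat /u /v /Y; ring.
  by rewrite !sum_affine sum_lines_through -/n -/c -/s /u /v /lin; ring.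
rewrite sum_proper_flats [X in _ + X]big1 ?addr0; last first.
  move=> F Fl; rewrite big_mkcondr sum_proper_flats !big1 ?addr0 // => [G Gl|x xE].
    by rewrite (negPf (line_antichain Fl Gl)).
  case: ifP => // Fx; move: (line_neq0 Fl) Fx.
  by rewrite properE subset1 => /negPf -> /andP[/orP[/eqP ->|//]]; rewrite subxx.
transitivity (\sum_(x in E) #|[set F in lines | x \in F]|%:R * ((1 + Y) ^+ 3)%:P * 'X^2).
  apply: eq_bigr => x xE; rewrite big_mkcondr sum_proper_flats big1 ?add0r; last first.
    by move=> y yE; case: ifP => // /proper_card; rewrite !cards1.
  rewrite -big_mkcondr (eq_bigr (fun=> ((1 + Y) ^+ 3)%:P * 'X^2)); last first.
    move=> F /andP[Fl xF]; rewrite flag_poincare2 //; rewrite point_sub_line // in xF.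
    rewrite poincare_below_point // poincare_point_line // poincare_above_line //.
    have -> : #|[set [set x]; F]| = 2%N.
      rewrite cards2; case: eqP => // eqF; have [_ rF] := lineP _ Fl.
      by have [_] := set1_flat xE; rewrite eqF rF.
    by rewrite expr0 mulr1; congr (_%:P * _); rewrite /Y; ring.
  rewrite (eq_bigl (mem [set F in lines | x \in F])) => [|F].
    by rewrite sumr_const -mulrA mulr_natl.
  by rewrite [RHS]inE; apply: andb_id2l => Fl; rewrite point_sub_line.
rewrite -!mulr_suml -natr_sum sum_lines_through; congr (_ * _).
by rewrite -polyC_natr -polyCM.
Qed.

End SimpleRankThree.

(** * Passing to rational functions *)

Lemma peval_fracY (p : {poly int}) : peval p fracY = tofrac p.
Proof.
rewrite /peval /fracY -[in RHS](comp_polyXr p) /comp_poly.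
rewrite -horner_map /= -map_poly_comp /=; congr (_.[_]).
by apply: eq_map_poly => a /=; rewrite -[a]intz !rmorph_int.
Qed.

Lemma map_poly_quadratic (R S : comNzRingType) (f : {rmorphism R -> S}) (p q r : R) :
  map_poly f (p%:P + q%:P * 'X + r%:P * 'X^2) =
    (f p)%:P + (f q)%:P * 'X + (f r)%:P * 'X^2.
Proof. by rewrite !rmorphD !rmorphM /= !map_polyC !map_polyX. Qed.

Lemma peval_cubic (R : comNzRingType) (a b d e : int) (y : R) :
  peval (a%:P + b%:P * 'X + d%:P * 'X^2 + e%:P * 'X^3) y =
    a%:~R + b%:~R * y + d%:~R * y ^+ 2 + e%:~R * y ^+ 3.
Proof.
rewrite /peval !rmorphD !rmorphM /= !map_polyC map_polyX !hornerE /=; ring.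
Qed.

(** The substitution [y |-> y^-1] followed by multiplication by [y ^+ 3] reverses
    the coefficients. *)
Lemma peval_cubic_reverse (R : fieldType) (a b d e : int) (y : R) : y != 0 ->
  y ^+ 3 * peval (a%:P + b%:P * 'X + d%:P * 'X^2 + e%:P * 'X^3) y^-1 =
  peval (e%:P + d%:P * 'X + b%:P * 'X^2 + a%:P * 'X^3) y.
Proof. by move=> y0; rewrite !peval_cubic; field. Qed.

Theorem proposition3p2 (U : finType) (M : matroid U) (n c s : nat)
  (M_simple : simple_matroid M) (M_rank3 : rk M = 3%N)
  (n_def : n = #|ground M|)
  (c_def : c = #|flats_of_rank M 2|)
  (s_def : s = (\sum_(X in flats_of_rank M 2) #|X|)%N) :
  let phi : {poly int} :=
    (n%:Z + c%:Z - 2)%:P + (2 * s%:Z - n%:Z + c%:Z) *: 'X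
    + (2 * s%:Z - n%:Z + c%:Z) *: 'X^2 + (n%:Z + c%:Z - 2) *: 'X^3 in
  map_poly (@tofrac {poly int}) (coarse_flag M) =
    (peval (poincare M) fracY)%:P + (peval phi fracY)%:P * 'X
    + (fracY ^+ 3 * peval (poincare M) fracY^-1)%:P * 'X^2.
Proof.
move=> phi.
pose mu3 : int := 1 - n%:R + s%:R - c%:R.
pose rev : {poly int} := mu3%:P + (s%:R - c%:R)%:P * 'X + n%:R%:P * 'X^2 + 1%:P * 'X^3.
have pE : poincare M = 1%:P + n%:R%:P * 'X + (s%:R - c%:R)%:P * 'X^2 + mu3%:P * 'X^3.
  rewrite (poincare_simple_rank3 M_simple M_rank3) -n_def -c_def -s_def.
  by rewrite /mu3 !polyCB polyCD polyCB !polyC_natr polyC1.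
have phiE : phi = n%:R + c%:R - 2 + (2 * s%:R - n%:R + c%:R) * 'X
    + (2 * s%:R - n%:R + c%:R) * 'X^2 + (n%:R + c%:R - 2) * 'X^3.
  rewrite /phi -!mul_polyC -!natz.
  by rewrite !(polyCD, polyCN, polyCM, polyC_natr).
have -> : fracY ^+ 3 * peval (poincare M) fracY^-1 = peval rev fracY.
  by rewrite pE peval_cubic_reverse // /fracY tofrac_eq0 polyX_eq0.
rewrite !peval_fracY.
have -> : coarse_flag M = (poincare M)%:P + phi%:P * 'X + rev%:P * 'X^2.
  rewrite (coarse_flag_simple_rank3 M_simple M_rank3) -n_def -c_def -s_def.
  rewrite phiE /rev pE /mu3 !(polyCD, polyCN, polyCM, polyC_natr).
  ring.
exact: map_poly_quadratic.
Qed.
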